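(* Let $c_1>c_2>0$, $c_3>0$, $Q_*>0$, $c_+=\sqrt{(c_1^2+c_2^2)/2}$, $c_{12}=c_1/c_2$, $c_{32}=c_3/c_2$, and for $c_+<v<c_1$ let $$\mathcal P_1(v)=\frac{c_3c_1^2Q_*}{\sqrt{2v^2-c_1^2-c_2^2}}\sqrt{\frac{v^2-c_2^2}{c_1^2-v^2}}.$$ Then the minimum of $\mathcal P_1$ on $(c_+,c_1)$ is given by $$\frac{\mathcal P_{1,\min}}{c_3^2Q_*}=\frac{(1+\sqrt2)\,c_{12}^2}{c_{32}\sqrt{c_{12}^2-1}},$$ and it is achieved at $$\frac{v}{c_2}=\sqrt{1+\frac{\sqrt2}{2}\,(c_{12}^2-1)}.$$
   Context: $\mathcal P_1(v)$ is the external force on the stiffer string needed for steady supersonic splitting at speed $v$ in the continuous model of two strings (wave speeds $c_1,c_2$) connected by distributed bonds of stiffness $c_3^2$ and critical strain $Q_*$. *)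

(* Defs.v *)
From Stdlib Require Import Reals.
Open Scope R_scope.

Definition c_plus (c1 c2 : R) : R := sqrt ((c1 ^ 2 + c2 ^ 2) / 2).

(* Physically meaningful only for [c_plus c1 c2 < v < c1], where both radicands
   and both denominators are positive; outside this range the values are junk
   ([sqrt] of a negative number is 0, and [/ 0] is unspecified). *)
Definition P1 (c1 c2 c3 Qstar v : R) : R :=
  c3 * c1 ^ 2 * Qstar / sqrt (2 * v ^ 2 - c1 ^ 2 - c2 ^ 2)
  * sqrt ((v ^ 2 - c2 ^ 2) / (c1 ^ 2 - v ^ 2)).

Definition is_minimum_on (D : R -> Prop) (f : R -> R) (m : R) : Prop :=
  (exists x : R, D x /\ f x = m) /\ (forall x : R, D x -> m <= f x).

(* Main.v *)
(** In the variable [x = (v^2 - c2^2) / (c1^2 - c2^2)] the interval becomes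
    [(1/2, 1)] and [P1] is a constant times the square root of
    [x / ((2 x - 1) (1 - x))].  The minimum [(1 + sqrt 2)^2] of this quotient
    comes from completing the square:
    [x - (1 + sqrt 2)^2 (2 x - 1) (1 - x)
       = 2 (1 + sqrt 2)^2 (x - sqrt 2 / 2)^2]. *)
Require Import Defs.
From Stdlib Require Import Reals Lra Psatz.
Open Scope R_scope.

Lemma sqrt2_sqr : sqrt 2 * sqrt 2 = 2.
Proof. apply sqrt_sqrt; lra. Qed.

Lemma sqrt2_bounds : 1 < sqrt 2 < 2.
Proof.
  pose proof sqrt2_sqr as H2. pose proof (sqrt_pos 2) as H0. split; nra.
Qed.

(** An exact formula for the excess, rather than a bound, serves twice: its sign gives the
    inequality and its zero gives the equality case. *)
Lemma reduced_force_excess (x : R) :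
  1 / 2 < x < 1 ->
  x / ((2 * x - 1) * (1 - x)) - (1 + sqrt 2) ^ 2 =
  2 * (1 + sqrt 2) ^ 2 * (x - sqrt 2 / 2) ^ 2 / ((2 * x - 1) * (1 - x)).
Proof.
  intros Hx. pose proof sqrt2_sqr as H2.
  assert (Hnum : x - (1 + sqrt 2) ^ 2 * ((2 * x - 1) * (1 - x)) =
                 2 * (1 + sqrt 2) ^ 2 * (x - sqrt 2 / 2) ^ 2).
  { replace ((1 + sqrt 2) ^ 2) with (3 + 2 * sqrt 2) by nra.
    replace ((x - sqrt 2 / 2) ^ 2) with (x ^ 2 - x * sqrt 2 + 1 / 2) by nra.
    nra. }
  rewrite <- Hnum. field. lra.
Qed.

Lemma reduced_force_ge (x : R) :
  1 / 2 < x < 1 -> 1 + sqrt 2 <= sqrt (x / ((2 * x - 1) * (1 - x))).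
Proof.
  intros Hx. pose proof (reduced_force_excess x Hx) as He.
  pose proof sqrt2_bounds as Hb.
  rewrite <- (sqrt_pow2 (1 + sqrt 2)) by lra.
  apply sqrt_le_1_alt.
  assert (0 <= 2 * (1 + sqrt 2) ^ 2 * (x - sqrt 2 / 2) ^ 2
               / ((2 * x - 1) * (1 - x))); [|lra].
  apply Rmult_le_pos.
  - apply Rmult_le_pos; [|apply pow2_ge_0].
    apply Rmult_le_pos; [lra | apply pow2_ge_0].
  - apply Rlt_le, Rinv_0_lt_compat, Rmult_lt_0_compat; lra.
Qed.

(** In the excess formula every factor except the square is strictly positive on the interval, so
    only the square can vanish. This is the source of the uniqueness of the minimizer. *)
Lemma reduced_force_eq_iff (x : R) :
  1 / 2 < x < 1 ->
  sqrt (x / ((2 * x - 1) * (1 - x))) = 1 + sqrt 2 <-> x = sqrt 2 / 2.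
Proof.
  intros Hx. pose proof (reduced_force_excess x Hx) as He.
  pose proof sqrt2_bounds as Hb.
  assert (Hd : 0 < (2 * x - 1) * (1 - x)) by (apply Rmult_lt_0_compat; lra).
  split; intros H.
  - assert (Hs : x / ((2 * x - 1) * (1 - x)) = (1 + sqrt 2) ^ 2).
    { rewrite <- H, pow2_sqrt; [reflexivity|].
      apply Rlt_le, Rdiv_lt_0_compat; lra. }
    rewrite Hs, Rminus_diag in He. symmetry in He.
    apply Rmult_integral in He. destruct He as [He | He].
    + assert (0 < (1 + sqrt 2) ^ 2) by nra.
      apply Rmult_integral in He. destruct He as [He | He]; nra.
    (* Division unfolds to multiplication by an inverse, so the zero product also yields the case of
       a vanishing inverse, excluded by [Hd]. *)
    + pose proof (Rinv_0_lt_compat _ Hd). lra.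
  - rewrite <- (sqrt_pow2 (1 + sqrt 2)) by lra. f_equal.
    replace (x - sqrt 2 / 2) with 0 in He by lra.
    replace (2 * (1 + sqrt 2) ^ 2 * 0 ^ 2 / ((2 * x - 1) * (1 - x)))
      with 0 in He by (field; lra).
    lra.
Qed.

Section ReducedVariable.

Variables c1 c2 : R.
Hypotheses (c2_pos : 0 < c2) (c2_lt_c1 : c2 < c1).

Let red (v : R) : R := (v ^ 2 - c2 ^ 2) / (c1 ^ 2 - c2 ^ 2).

Lemma sqr_gap_pos : 0 < c1 ^ 2 - c2 ^ 2.
Proof. nra. Qed.

Lemma red_spec (v : R) : v ^ 2 = c2 ^ 2 + (c1 ^ 2 - c2 ^ 2) * red v.
Proof. pose proof sqr_gap_pos. unfold red. field. lra. Qed.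

(** The square of [c_plus c1 c2] is the midpoint of [c2 ^ 2] and [c1 ^ 2], which [red] sends to 1/2,
    while [c1] goes to 1. Since [red] sees only [v ^ 2], the sign of [v] is recorded separately. *)
Lemma supersonic_red_iff (v : R) :
  c_plus c1 c2 < v < c1 <-> 0 <= v /\ 1 / 2 < red v < 1.
Proof.
  pose proof sqr_gap_pos as Hd. pose proof (red_spec v) as Hv.
  assert (Hc : 0 <= (c1 ^ 2 + c2 ^ 2) / 2) by nra.
  pose proof (sqrt_pos ((c1 ^ 2 + c2 ^ 2) / 2)) as Hp.
  pose proof (pow2_sqrt _ Hc) as Hq.
  unfold c_plus. split.
  - intros [H1 H2]. split; [lra|]. split; nra.
  - intros [H0 [H1 H2]]. split; nra.
Qed.

(** Each difference of squares in [P1] is [d = c1 ^ 2 - c2 ^ 2] times an affine function of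
    [x = red v]. The factor [d] cancels in the quotient under the second root and leaves [sqrt d]
    from the first. *)
Lemma P1_reduced (c3 Q v : R) :
  1 / 2 < red v < 1 ->
  P1 c1 c2 c3 Q v =
  c3 * c1 ^ 2 * Q / sqrt (c1 ^ 2 - c2 ^ 2)
  * sqrt (red v / ((2 * red v - 1) * (1 - red v))).
Proof.
  intros Hx. pose proof sqr_gap_pos as Hd. pose proof (red_spec v) as Hv.
  unfold P1. rewrite Hv. set (x := red v) in *. set (d := c1 ^ 2 - c2 ^ 2) in *.
  replace (2 * (c2 ^ 2 + d * x) - c1 ^ 2 - c2 ^ 2) with (d * (2 * x - 1))
    by (unfold d; ring).
  replace (c2 ^ 2 + d * x - c2 ^ 2) with (d * x) by ring.
  replace (c1 ^ 2 - (c2 ^ 2 + d * x)) with (d * (1 - x)) by (unfold d; ring).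
  replace (d * x / (d * (1 - x))) with (x / (1 - x)) by (field; lra).
  (* Grouped this way, [sqrt (x / (1 - x))] occurs on both sides as one atom for [field]. *)
  replace (x / ((2 * x - 1) * (1 - x))) with (x / (1 - x) / (2 * x - 1))
    by (field; lra).
  rewrite (sqrt_mult d) by lra.
  rewrite (sqrt_div (x / (1 - x)) (2 * x - 1))
    by (try lra; apply Rlt_le, Rdiv_lt_0_compat; lra).
  pose proof (sqrt_lt_R0 d Hd).
  assert (0 < sqrt (2 * x - 1)) by (apply sqrt_lt_R0; lra).
  field. lra.
Qed.

(** Solving [red v = a] for [v ^ 2] and dividing by [c2 ^ 2] gives the radicand; [0 <= a] keeps it
    nonnegative, away from the default value of [sqrt]. A root is nonnegative, which recovers
    [0 <= v]. *)
Lemma red_eq_iff (v a : R) :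
  0 <= a ->
  0 <= v /\ red v = a <-> v / c2 = sqrt (1 + a * ((c1 / c2) ^ 2 - 1)).
Proof.
  intros Ha. pose proof sqr_gap_pos as Hd. pose proof (red_spec v) as Hv.
  assert (Hr : 1 + a * ((c1 / c2) ^ 2 - 1) =
               (c2 ^ 2 + (c1 ^ 2 - c2 ^ 2) * a) / c2 ^ 2) by (field; lra).
  assert (Hn : 0 <= (c2 ^ 2 + (c1 ^ 2 - c2 ^ 2) * a) / c2 ^ 2).
  { apply Rmult_le_pos; [nra|]. apply Rlt_le, Rinv_0_lt_compat; nra. }
  rewrite Hr. split.
  - intros [H0 H]. rewrite H in Hv. rewrite <- Hv.
    replace (v ^ 2 / c2 ^ 2) with ((v / c2) ^ 2) by (field; lra).
    rewrite sqrt_pow2; [reflexivity|].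
    apply Rmult_le_pos; [lra|]. apply Rlt_le, Rinv_0_lt_compat; lra.
  - intros H.
    assert (Hvc : v = c2 * (v / c2)) by (field; lra).
    split.
    + rewrite Hvc, H. apply Rmult_le_pos; [lra | apply sqrt_pos].
    + assert (Hv2 : v ^ 2 = c2 ^ 2 + (c1 ^ 2 - c2 ^ 2) * a).
      { rewrite Hvc, H, Rpow_mult_distr, pow2_sqrt by exact Hn. field. lra. }
      unfold red. rewrite Hv2. field. lra.
Qed.

End ReducedVariable.

Theorem mainTheorem5 :
  forall c1 c2 c3 Qstar : R,
    c1 > c2 -> c2 > 0 -> c3 > 0 -> Qstar > 0 ->
    let c12 := c1 / c2 in
    let c32 := c3 / c2 in
    exists P1min : R,
      is_minimum_on (fun v => c_plus c1 c2 < v < c1) (P1 c1 c2 c3 Qstar) P1min /\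
      P1min / (c3 ^ 2 * Qstar)
        = (1 + sqrt 2) * c12 ^ 2 / (c32 * sqrt (c12 ^ 2 - 1)) /\
      (forall v : R,
         (c_plus c1 c2 < v < c1 /\ P1 c1 c2 c3 Qstar v = P1min) <->
         v / c2 = sqrt (1 + sqrt 2 / 2 * (c12 ^ 2 - 1))).
Proof.
  intros c1 c2 c3 Q H12 H2 H3 HQ c12 c32.
  pose proof (sqr_gap_pos c1 c2 H2 H12) as Hd.
  pose proof (sqrt_lt_R0 _ Hd) as Hsd.
  pose proof sqrt2_bounds as Hb.
  set (K := c3 * c1 ^ 2 * Q / sqrt (c1 ^ 2 - c2 ^ 2)).
  assert (HK : 0 < K).
  { apply Rdiv_lt_0_compat; [|exact Hsd].
    apply Rmult_lt_0_compat; [|lra].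
    apply Rmult_lt_0_compat; [lra|]. apply pow_lt; lra. }
  (* Proved before the witness is chosen: read from right to left it gives attainment, including
     membership in the interval; from left to right, uniqueness. *)
  assert (Hiff : forall v : R,
    (c_plus c1 c2 < v < c1 /\ P1 c1 c2 c3 Q v = K * (1 + sqrt 2)) <->
    v / c2 = sqrt (1 + sqrt 2 / 2 * (c12 ^ 2 - 1))).
  { intros v. unfold c12.
    rewrite <- (red_eq_iff c1 c2 H2 H12) by lra.
    rewrite (supersonic_red_iff c1 c2 H2 H12). split.
    - intros [[H0 Hx] HP]. split; [exact H0|].
      rewrite (P1_reduced c1 c2 H2 H12 c3 Q v Hx) in HP.
      apply (reduced_force_eq_iff _ Hx).
      apply (Rmult_eq_reg_l K); [exact HP | lra].
    - intros [H0 Hx].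
      (* The critical value [sqrt 2 / 2] lies in the interval because [1 < sqrt 2 < 2]. *)
      assert (Hr : 1 / 2 < (v ^ 2 - c2 ^ 2) / (c1 ^ 2 - c2 ^ 2) < 1) by lra.
      split; [split; [exact H0 | exact Hr]|].
      rewrite (P1_reduced c1 c2 H2 H12 c3 Q v Hr).
      unfold K. f_equal. apply (reduced_force_eq_iff _ Hr). exact Hx. }
  exists (K * (1 + sqrt 2)). split; [split|split].
  - exists (c2 * sqrt (1 + sqrt 2 / 2 * (c12 ^ 2 - 1))).
    apply Hiff. field. lra.
  - intros v Hv.
    apply (supersonic_red_iff c1 c2 H2 H12) in Hv. destruct Hv as [_ Hx].
    rewrite (P1_reduced c1 c2 H2 H12 c3 Q v Hx).
    apply Rmult_le_compat_l; [exact (Rlt_le _ _ HK)|]. apply reduced_force_ge, Hx.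
  (* With a single root left besides [sqrt 2], the closed form is a rational identity. *)
  - assert (Hs : sqrt (c12 ^ 2 - 1) = sqrt (c1 ^ 2 - c2 ^ 2) / c2).
    { unfold c12.
      replace ((c1 / c2) ^ 2 - 1) with ((c1 ^ 2 - c2 ^ 2) / c2 ^ 2)
        by (field; lra).
      rewrite sqrt_div by nra. rewrite sqrt_pow2 by lra. reflexivity. }
    rewrite Hs. unfold K, c12, c32. field. lra.
  - exact Hiff.
Qed.
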